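(* Let $(\Omega_0,\Sigma_0)$ be a standard Borel space, $(\Omega,\Sigma,\mu)$ a standard probability space, and let $\xi\equiv(\xi_n)_{n\ge0}$ be a sequence of $(\Omega_0,\Sigma_0)$-valued random variables on $(\Omega,\Sigma,\mu)$ which is partially spreadable, implemented by $\Sigma$-measurable $\mu$-preserving maps $\{\eta_n\}_{n\ge 0}$ on $\Omega$ having the generating property. Suppose that the $\sigma$-algebras $\Sigma^\xi$ and $\mathcal{J}_0:=\bigcap_{k\ge 1}\mathcal{I}_{\eta_k}$ are conditionally independent over $\sigma\{\xi_0\}$. Then $\xi$ is a stationary Markov sequence.
   Context: All $\sigma$-subalgebras are completed with respect to $\mu$-null sets. For $I\subset\mathbb{N}_0$, $\Sigma^\xi_I$ is the $\sigma$-subalgebra of $\Sigma$ generated by $\{\xi_i:i\in I\}$; $\Sigma^\xi:=\Sigma^\xi_{\mathbb{N}_0}$ and $\sigma\{\xi_n\}:=\Sigma^\xi_{\{n\}}$. For a $\sigma$-subalgebra $\tilde\Sigma$, $\mathbb{E}_{\tilde\Sigma}$ is the $\mu$-preserving conditional expectation from $L^\infty(\Omega,\Sigma,\mu)$ onto $L^\infty(\Omega,\tilde\Sigma,\mu|_{\tilde\Sigma})$. Partial spreadability of $\xi$ implemented by $\{\eta_n\}_{n\ge0}$: $\eta_\ell\circ\eta_k=\eta_k\circ\eta_{\ell+1}$ for all $0\le k<\ell<\infty$ (so that the operators $\alpha_n(f):=f\circ\eta_n$ satisfy $\alpha_k\alpha_\ell=\alpha_{\ell+1}\alpha_k$ for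 $k<\ell$, the relations of the Thompson monoid $F^+$), $\xi_0=\xi_0\circ\eta_k$ for all $k>0$, and $\xi_n=\xi_0\circ\eta_0^n$ for all $n\ge 0$. $\mathcal{I}_{\eta_k}$ is the $\sigma$-subalgebra of $\mu$-almost $\eta_k$-invariant sets in $\Sigma$, and $\mathcal{J}_n:=\bigcap_{k\ge n+1}\mathcal{I}_{\eta_k}$. The generating property means $\sigma\{\mathcal{J}_n\mid n\ge 0\}=\Sigma$. Stationary: $(\xi_0,\xi_1,\dots)$ and $(\xi_n,\xi_{n+1},\dots)$ have the same distribution for all $n\ge1$. Markov sequence: $\mathbb{E}_{\Sigma^\xi_{[0,n]}}\mathbb{E}_{\sigma\{\xi_{n+1}\}}=\mathbb{E}_{\sigma\{\xi_n\}}\mathbb{E}_{\sigma\{\xi_{n+1}\}}$ for all $n\ge 0$, with $[0,n]=\{0,\dots,n\}$. *)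

(* Defs.v *)
From HB Require Import structures.
From mathcomp Require Import all_boot all_order all_algebra.
From mathcomp Require Import all_classical all_reals all_analysis.

Set Implicit Arguments.
Unset Strict Implicit.
Unset Printing Implicit Defensive.

Import Order.TTheory GRing.Theory Num.Theory.
Import numFieldNormedType.Exports.

Local Open Scope classical_set_scope.
Local Open Scope ring_scope.

(* [B] is the family of Borel subsets of [E] for some Polish topology on [E],
   the topology being transported along a bijection with a Polish space [X]. *)
Definition standard_borel_on (R : realType) (T : Type) (E : set T)
    (B : set (set T)) : Prop :=
  exists (X : completePseudoMetricType R) (f : T -> X),
    [/\ hausdorff_space X,
        exists2 D : set X, countable D & dense D,
        set_bij E [set: X] f &
        B = preimage_set_system E f <<s open >>].

Definition standard_borel (R : realType) (d : measure_display)
    (T : measurableType d) : Prop :=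
  @standard_borel_on R T setT measurable.

(* Standardness up to null sets: on a conull set [E] the sigma-algebra of [T]
   lies between a standard Borel sigma-algebra [B] and its mu-completion.
   Completeness is not imposed, so this includes Borel probability measures on
   standard Borel spaces, their completions, and Lebesgue-Rokhlin spaces. *)
Definition standard_probability_space (R : realType) (d : measure_display)
    (T : measurableType d) (mu : probability T R) : Prop :=
  exists (E : set T) (B : set (set T)),
    [/\ measurable E, mu (~` E) = 0%E, standard_borel_on R E B,
        B `<=` measurable &
        forall A, measurable A -> exists2 A', B A' & mu (A `+` A') = 0%E].

Section sub_sigma_algebras.
Context (R : realType) (d d0 : measure_display).
Context (T : measurableType d) (T0 : measurableType d0).
Variable mu : probability T R.
Implicit Types (F : set (set T)) (xi : nat -> T -> T0) (eta : nat -> T -> T).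

(* The mu-null sets are those belonging to the ambient sigma-algebra, so that
   the result is again a sub-sigma-algebra of it. *)
Definition completed_sigma F : set (set T) :=
  <<s F `|` [set N | measurable N /\ mu N = 0%E] >>.

Definition sigma_rv xi (I : set nat) : set (set T) :=
  completed_sigma (\bigcup_(i in I) g_sigma_algebra_preimage (xi i)).

(* This family and [fixed_sigma] below are sigma-algebras containing all
   mu-null sets whenever the maps involved preserve mu. *)
Definition almost_invariant (h : T -> T) : set (set T) :=
  [set A | measurable A /\ mu (A `+` h @^-1` A) = 0%E].

Definition fixed_sigma eta (n : nat) : set (set T) :=
  \bigcap_(k in [set k | (n < k)%N]) almost_invariant (eta k).

Definition generating eta : Prop :=
  completed_sigma (\bigcup_n fixed_sigma eta n) = measurable.

End sub_sigma_algebras.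

Section conditional_expectation.
Context (R : realType) (d : measure_display) (T : measurableType d).
Variable mu : probability T R.
Implicit Types (G : set (set T)) (f g : T -> R).

(* Representatives of elements of L^oo(T, G, mu) for a sub-sigma-algebra [G]. *)
Definition Linfty G : set (T -> R) :=
  [set f | f \in Lfun mu +oo%E /\ g_sigma_algebra_preimage f `<=` G].

Definition is_condexp G f : set (T -> R) :=
  [set g | Linfty G g /\
    forall A, G A ->
      (\int[mu]_(x in A) (g x)%:E = \int[mu]_(x in A) (f x)%:E)%E].

(* A version of the conditional expectation.  For [f] in L^oo(mu) and [G] a
   sub-sigma-algebra, versions exist by the Radon-Nikodym theorem and are
   unique up to mu-null sets; the default value 0 is then never used. *)
Definition condexp G f : T -> R := xget (cst 0) (is_condexp G f).

Definition cond_independent (G1 G2 G0 : set (set T)) : Prop :=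
  forall f g, Linfty G1 f -> Linfty G2 g ->
    condexp G0 (f \* g) = condexp G0 f \* condexp G0 g %[ae mu].

End conditional_expectation.

Section sequences_of_random_variables.
Context (R : realType) (d d0 : measure_display).
Context (T : measurableType d) (T0 : measurableType d0).
Variable mu : probability T R.

Definition measure_preserving (h : {mfun T >-> T}) : Prop :=
  forall A, measurable A -> pushforward mu h A = mu A.

Record partially_spreadable (xi : nat -> {RV mu >-> T0})
    (eta : nat -> {mfun T >-> T}) : Prop := {
  implementation_preserving : forall n, measure_preserving (eta n);
  implementation_relations : forall k l, (k < l)%N ->
    eta l \o eta k =1 eta k \o eta l.+1;
  implementation_localized : forall k, (0 < k)%N -> xi 0%N =1 xi 0%N \o eta k;
  implementation_stationary : forall n, xi n =1 xi 0%N \o iter n (eta 0%N) }.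

(* The product sigma-algebra on T0^nat, generated by the coordinate maps. *)
Definition seq_sigma : set (set (nat -> T0)) :=
  <<s \bigcup_i g_sigma_algebra_preimage (fun w : nat -> T0 => w i) >>.

Definition stationary_sequence (xi : nat -> {RV mu >-> T0}) : Prop :=
  forall n C, (1 <= n)%N -> seq_sigma C ->
    mu ((fun t i => xi i t) @^-1` C) = mu ((fun t i => xi (n + i)%N t) @^-1` C).

Definition markov_sequence (xi : nat -> {RV mu >-> T0}) : Prop :=
  forall n f, f \in Lfun mu +oo%E ->
    let Ef := condexp mu (sigma_rv mu xi [set n.+1]) f in
    condexp mu (sigma_rv mu xi [set i | (i <= n)%N]) Ef
    = condexp mu (sigma_rv mu xi [set n]) Ef %[ae mu].

End sequences_of_random_variables.

(* Main.v *)
Require Import Defs.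
From HB Require Import structures.
From mathcomp Require Import all_boot all_order all_algebra.
From mathcomp Require Import all_classical all_reals all_analysis.
From mathcomp Require Import ess_sup_inf measurable_realfun lra.

(* Write [h] for [eta 0^n].  The generating property makes every measurable set
   asymptotically invariant under [eta k] as k grows, and with the Thompson
   monoid relations this forces [eta k]-invariant sets to be [eta l]-invariant
   for l > k.  Let B be an event of xi_0, ..., xi_n; it is [eta n.+1]-invariant.
   The density phi of [A |-> mu (B `&` h @^-1` A)] is [eta 1]-invariant, because
   [eta 1 \o h = h \o eta n.+1], so it is measurable for J_0, and conditional
   independence allows replacing it by psi = E[phi | xi_0] on events of xi.
   Pulling back along [h], the function [psi \o h] of xi_n has the same
   integrals as [\1_B] over the events of xi_n and over those of xi_(n+1), which
   is the Markov property at time n. *)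

Set Implicit Arguments.
Unset Strict Implicit.
Unset Printing Implicit Defensive.

Import Order.TTheory GRing.Theory Num.Theory.
Import numFieldNormedType.Exports.

Local Open Scope classical_set_scope.
Local Open Scope ring_scope.

(** * Symmetric differences and their measure *)

Section set_lemmas.
Context (T : Type).
Implicit Types A B : set T.

Lemma setYCC A B : ~` A `+` ~` B = A `+` B.
Proof.
apply/seteqP; split=> x; rewrite !setY_def /setU /setD /setC/=;
have [Ax|Ax] := pselect (A x); have [Bx|Bx] := pselect (B x); tauto.
Qed.

Lemma setYU_subset A B A' B' :
  (A `|` B) `+` (A' `|` B') `<=` (A `+` A') `|` (B `+` B').
Proof. by move=> x; rewrite !setY_def /setU /setD/=; tauto. Qed.

Lemma setY_bigcup_subset (F G : nat -> set T) :
  \bigcup_i F i `+` \bigcup_i G i `<=` \bigcup_i (F i `+` G i).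
Proof.
move=> x [[[i _ Fx] Gx]|[[i _ Gx] Fx]]; exists i => //.
  by left; split => // Gi; apply: Gx; exists i.
by right; split => // Fi; apply: Fx; exists i.
Qed.

Lemma preimage_setY T' (h : T' -> T) A B :
  h @^-1` (A `+` B) = h @^-1` A `+` h @^-1` B.
Proof. by []. Qed.

End set_lemmas.

Section symmetric_difference.
Context (R : realType) (d : measure_display) (T : measurableType d).
Variable mu : probability T R.
Implicit Types A B C : set T.

Lemma measurable_setY A B :
  measurable A -> measurable B -> measurable (A `+` B).
Proof.
by move=> mA mB; rewrite setY_def; apply: measurableU; exact: measurableD.
Qed.

(** This makes the measure of a symmetric difference a pseudometric on events, in which the
    invariance estimates below are carried out. *)
Lemma measure_setY_triangle A B C :
  measurable A -> measurable B -> measurable C ->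
  (mu (A `+` C) <= mu (A `+` B) + mu (B `+` C))%E.
Proof.
move=> mA mB mC; apply: le_trans (measureU2 _ _ _); last 2 first.
- exact: measurable_setY.
- exact: measurable_setY.
apply: le_measure; rewrite ?inE; first exact: measurable_setY.
  by apply: measurableU; exact: measurable_setY.
move=> x; have [Bx|Bx] := pselect (B x);
  by move=> [[Ax Cx]|[Cx Ax]]; rewrite !setY_def /setU /setD/=; tauto.
Qed.

Lemma measure_bigcup_null (F : nat -> set T) :
  (forall i, measurable (F i)) -> (forall i, mu (F i) = 0%E) ->
  mu (\bigcup_i F i) = 0%E.
Proof.
move=> mF F0; apply/(negligibleP mu (bigcupT_measurable F mF)).
by apply: negligible_bigcup => i; exact/(negligibleP mu (mF i))/F0.
Qed.

(** The remainders decrease to the empty set and [mu] is finite, so continuity from above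
    applies. *)
Lemma measure_bigcup_tail (F : nat -> set T) (e : R) : 0 < e ->
  (forall i, measurable (F i)) ->
  exists n, (mu (\bigcup_i F i `\` \big[setU/set0]_(i < n) F i) <= e%:E)%E.
Proof.
move=> e0 mF; pose D n := \bigcup_i F i `\` \big[setU/set0]_(i < n) F i.
have mU : measurable (\bigcup_i F i) by exact: bigcupT_measurable.
have mD n : measurable (D n).
  by apply: measurableD => //; apply: bigsetU_measurable.
have D0 : \bigcap_n D n = set0.
  rewrite -subset0 => x Dx; have [[i _ Fi] _] := Dx 0%N I.
  by have [_] := Dx i.+1 I; apply; rewrite big_ord_recr/=; right.
have := @nonincreasing_cvg_mu _ _ _ mu D; rewrite D0 measure0 => /(_ _ mD) cD.
have {cD} : mu \o D @ \oo --> 0%E.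
  apply: cD => //; first by rewrite -ge0_fin_numE// fin_num_measure.
  move=> m n mn; apply/subsetPset => x [Ux Nx]; split => // Bx; apply: Nx.
  by move: x Bx {Ux}; apply: subset_bigsetU.
move=> /fine_cvgP[_] /cvgrPdist_le /(_ _ e0)[n _ /(_ n (leqnn n))] /=.
rewrite sub0r normrN ger0_norm ?fine_ge0// => H; exists n.
by rewrite -[leLHS]fineK ?lee_fin//; exact: fin_num_measure (mD n).
Qed.

End symmetric_difference.

(** * Measure-preserving maps and asymptotically invariant sets *)

Section preserved_measure.
Context (R : realType) (d : measure_display) (T : measurableType d).
Variable mu : probability T R.
Implicit Types (A B : set T) (h : T -> T).

(** Stated for bare functions, so that iterates need no bundled structure. *)
Definition preserves h : Prop :=
  measurable_fun setT h /\ forall A, measurable A -> mu (h @^-1` A) = mu A.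

Lemma preserves_measurable h A :
  preserves h -> measurable A -> measurable (h @^-1` A).
Proof. by move=> [mh _] mA; rewrite -[X in measurable X]setTI; exact: mh. Qed.

Lemma preserves_iter h n : preserves h -> preserves (iter n h).
Proof.
move=> ph; elim: n => [|n IH].
  by split => //; exact: (@measurable_id _ _ setT).
split; first exact: measurableT_comp ph.1 IH.1.
move=> A mA; rewrite -[RHS](ph.2 _ mA).
exact: IH.2 (preserves_measurable ph mA).
Qed.

(** Telescoping: each further iterate costs the measure of a preimage of the null set on which [A]
    and its [h]-preimage differ, and iterates preserve [mu]. *)
Lemma iter_almost_invariant h n A : preserves h -> almost_invariant mu h A ->
  mu (A `+` iter n h @^-1` A) = 0%E.
Proof.
move=> ph [mA hA]; elim: n => [|n IH]; first by rewrite setYK measure0.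
have mh m := preserves_measurable (preserves_iter m ph) mA.
apply/eqP; rewrite -measure_le0.
apply: le_trans (measure_setY_triangle mu mA (mh n) (mh n.+1)) _.
rewrite IH add0e -[iter n.+1 h @^-1` A]/(iter n h @^-1` (h @^-1` A)).
rewrite -preimage_setY (preserves_iter n ph).2 ?hA//.
by apply: measurable_setY => //; exact: (mh 1%N).
Qed.

(* Almost invariance is the special case of a constant sequence [h]. *)
Definition asymptotically_invariant (h : nat -> T -> T) : set (set T) :=
  [set A | measurable A /\ forall e : R, 0 < e ->
    \forall k \near \oo, (mu (A `+` h k @^-1` A) <= e%:E)%E].

Lemma asymptotically_invariantU (h : nat -> T -> T) A B :
  (forall k, preserves (h k)) ->
  asymptotically_invariant h A -> asymptotically_invariant h B ->
  asymptotically_invariant h (A `|` B).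
Proof.
move=> ph [mA hA] [mB hB]; split; first exact: measurableU.
move=> e e0; have e20 : 0 < e / 2 by rewrite divr_gt0.
apply: filterS2 (hA _ e20) (hB _ e20) => k hAk hBk.
have mhA := preserves_measurable (ph k) mA.
have mhB := preserves_measurable (ph k) mB.
rewrite preimage_setU; apply: (@le_trans _ _ (e / 2 + e / 2)%:E); last first.
  by rewrite -splitr.
rewrite EFinD; apply: le_trans (leeD hAk hBk).
apply: le_trans (measureU2 _ _ _); [|exact: measurable_setY..].
apply: le_measure; rewrite ?inE; last exact: setYU_subset.
  by apply: measurable_setY; exact: measurableU.
by apply: measurableU; exact: measurable_setY.
Qed.

(** Only countable unions need work: a finite subunion is close to the union, and stays equally
    close after taking preimages because every [h k] preserves [mu]. Invariance on a generated
    sigma-algebra thereby reduces to generators. *)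
Lemma sigma_algebra_asymptotically_invariant (h : nat -> T -> T) :
  (forall k, preserves (h k)) ->
  sigma_algebra setT (asymptotically_invariant h).
Proof.
move=> ph.
have h0 : asymptotically_invariant h set0.
  split => // e e0; apply: nearW => k.
  by rewrite preimage_set0 setYK measure0 lee_fin ltW.
split => // [A [mA hA]|F hF].
  rewrite setTD; split; first exact: measurableC.
  by move=> e /hA; apply: filterS => k; rewrite preimage_setC setYCC.
have mF i : measurable (F i) by have [] := hF i.
have mU : measurable (\bigcup_i F i) by exact: bigcupT_measurable.
(* Three errors: the union against a finite subunion, the subunion against its preimage, and that
   preimage against the preimage of the union. *)
split => // e e0; have e30 : 0 < e / 3 by rewrite divr_gt0.
have [n tail] := measure_bigcup_tail mu e30 mF.
pose U := \big[setU/set0]_(i < n) F i.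
have [mUn hU] : asymptotically_invariant h U.
  by apply: (big_ind (asymptotically_invariant h)) => // *;
    exact: asymptotically_invariantU.
have dU : (mu (\bigcup_i F i `+` U) <= (e / 3)%:E)%E.
  rewrite setY_def (_ : U `\` _ = set0) ?setU0// setD_eq0.
  by rewrite /U -bigcup_mkord; apply: bigcup_sub => i _; exact: bigcup_sup.
apply: filterS (hU _ e30) => k hUk.
have mhU := preserves_measurable (ph k) mU.
have mhUn := preserves_measurable (ph k) mUn.
apply: le_trans (measure_setY_triangle mu mU mUn mhU) _.
apply: (@le_trans _ _ ((e / 3)%:E + ((e / 3)%:E + (e / 3)%:E))%E).
  apply: leeD => //; apply: le_trans (measure_setY_triangle mu mUn mhUn mhU) _.
  apply: leeD => //.
  rewrite -preimage_setY (ph k).2; last exact: measurable_setY.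
  by rewrite setYC.
by rewrite -!EFinD lee_fin; lra.
Qed.

Lemma null_asymptotically_invariant (h : nat -> T -> T) A :
  (forall k, preserves (h k)) -> measurable A -> mu A = 0%E ->
  asymptotically_invariant h A.
Proof.
move=> ph mA A0; split => // e e0; apply: nearW => k.
have mhA := preserves_measurable (ph k) mA.
apply: (@le_trans _ _ (mu (A `|` h k @^-1` A))).
  apply: le_measure; rewrite ?inE; first exact: measurable_setY.
    exact: measurableU.
  by rewrite setY_def; apply: setUSS; exact: subDsetl.
have hA0 : mu (h k @^-1` A) = 0%E by rewrite (ph k).2.
by rewrite (measureU0 mA mhA hA0) [leLHS]A0 lee_fin ltW.
Qed.

Lemma almost_invariantP h A :
  almost_invariant mu h A <-> asymptotically_invariant (fun=> h) A.
Proof.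
split=> -[mA hA]; split => //.
  by move=> e e0; apply: nearW => _; rewrite hA lee_fin ltW.
apply/eqP; rewrite -measure_le0; apply/lee_addgt0Pr => e e0; rewrite add0e.
by have [n _ /(_ n (leqnn n))] := hA e e0.
Qed.

End preserved_measure.

(** * Completed sub-sigma-algebras *)

Section completion.
Context (R : realType) (d : measure_display) (T : measurableType d).
Variable mu : probability T R.
Implicit Types (A N : set T) (F G : set (set T)).

(** Serves as the induction principle for completed sigma-algebras. *)
Lemma completed_sigma_sub F G : sigma_algebra setT G -> F `<=` G ->
  (forall N, measurable N -> mu N = 0%E -> G N) -> completed_sigma mu F `<=` G.
Proof.
move=> sG FG NG; apply: smallest_sub => // A [/FG//|[mA A0]]; exact: NG.
Qed.

Lemma completed_sigma_gen F : F `<=` completed_sigma mu F.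
Proof. by move=> A FA; apply: sub_sigma_algebra; left. Qed.

Lemma completed_sigma_null F N :
  measurable N -> mu N = 0%E -> completed_sigma mu F N.
Proof. by move=> mN N0; apply: sub_sigma_algebra; right. Qed.

Lemma sigma_algebra_completed F : sigma_algebra setT (completed_sigma mu F).
Proof. exact: smallest_sigma_algebra. Qed.

Lemma sigma_algebra_measurable : sigma_algebra setT (@measurable _ T).
Proof.
split=> // [A mA|F mF]; first by rewrite setTD; exact: measurableC.
exact: bigcupT_measurable.
Qed.

Lemma completed_sigma_measurable F :
  F `<=` measurable -> completed_sigma mu F `<=` measurable.
Proof.
by move=> mF; apply: completed_sigma_sub => //; exact: sigma_algebra_measurable.
Qed.

Lemma completed_sigmaS F G : F `<=` G ->
  completed_sigma mu F `<=` completed_sigma mu G.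
Proof.
move=> FG; apply: smallest_sub; first exact: sigma_algebra_completed.
by move=> A [/FG FA|NA]; apply: sub_sigma_algebra; [left|right].
Qed.

End completion.

(** * Essentially bounded functions *)

Section essentially_bounded.
Context (R : realType) (d : measure_display) (T : measurableType d).
Variable mu : probability T R.
Implicit Types (f g u : T -> R) (A : set T) (G : set (set T)).

Lemma LinfP f : f \in Lfun mu +oo%E <->
  measurable_fun setT f /\ exists M, \forall x \ae mu, `|f x| <= M.
Proof.
(* The norm at exponent infinity is defined by cases on whether the space has positive measure. *)
have mu1 : (0 < mu [set: T])%E by rewrite probability_setT lte01.
split=> [/andP[]|[mf [M fM]]].
  rewrite !inE => mf; rewrite /= /finite_norm unlock mu1.
  move=> /(@ess_supr_bounded _ _ _ mu (Num.norm \o f)) [M fM].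
  by split => //; exists M.
apply/andP; split; rewrite inE//= /finite_norm unlock mu1.
by apply: (@le_lt_trans _ _ M%:E); [apply/ess_supP; exact: fM|rewrite ltry].
Qed.

Lemma Linf_measurable f : f \in Lfun mu +oo%E -> measurable_fun setT f.
Proof. by case/LinfP. Qed.

Lemma Linf_bounded f M : measurable_fun setT f -> (forall x, `|f x| <= M) ->
  f \in Lfun mu +oo%E.
Proof. by move=> mf fM; apply/LinfP; split=> //; exists M; exact: aeW. Qed.

Lemma Linf_integrable f A : measurable A -> f \in Lfun mu +oo%E ->
  mu.-integrable A (EFin \o f).
Proof.
move=> mA Lf; apply: (@integrableS _ _ _ _ setT) => //; apply/Lfun1_integrable.
have muT : mu [set: T] \is a fin_num by exact: fin_num_measure.
exact: (Lfun_subset (lexx 1%E) (leey 1%E) muT (leey 1%E) Lf).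
Qed.

Lemma LinfB f g : f \in Lfun mu +oo%E -> g \in Lfun mu +oo%E ->
  (fun x => f x - g x) \in Lfun mu +oo%E.
Proof.
move=> /LinfP[mf [M fM]] /LinfP[mg [N gN]]; apply/LinfP; split.
  exact: measurable_funB.
exists (M + N); apply: filterS2 fM gN => x fM gN.
by rewrite (le_trans (ler_normB _ _))// lerD.
Qed.

Lemma LinfM f g : f \in Lfun mu +oo%E -> g \in Lfun mu +oo%E ->
  (fun x => f x * g x) \in Lfun mu +oo%E.
Proof.
move=> /LinfP[mf [M fM]] /LinfP[mg [N gN]]; apply/LinfP; split.
  exact: measurable_funM.
exists (M * N); apply: filterS2 fM gN => x fM gN.
by rewrite normrM ler_pM.
Qed.

Lemma Linf_cst (c : R) : (fun=> c) \in Lfun mu +oo%E.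
Proof. by apply: (@Linf_bounded _ `|c|). Qed.

Lemma Linf_indic A : measurable A -> \1_A \in Lfun mu +oo%E.
Proof.
move=> mA; apply: (@Linf_bounded _ 1); first exact: measurable_indic.
by move=> x; rewrite indicE; case: (x \in A); rewrite ?normr0 ?normr1.
Qed.

Lemma RintegralM_indic f A :
  \int[mu]_x (f x * \1_A x) = \int[mu]_(x in A) f x.
Proof. by rewrite [RHS]Rintegral_mkcond patch_indic. Qed.

Lemma Rintegral_sqr_eq0 f : f \in Lfun mu +oo%E ->
  \int[mu]_x (f x * f x) = 0 -> f = cst 0 %[ae mu].
Proof.
move=> Lf f0; have Lff := LinfM Lf Lf.
have : (\int[mu]_x `|(f x * f x)%:E| = 0)%E.
  rewrite -[RHS]/(0%R%:E) -f0 fineK; last first.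
    exact: integrable_fin_num (Linf_integrable measurableT Lff).
  by apply: eq_integral => x _; rewrite /= ger0_norm// -expr2 sqr_ge0.
move/ae_eq_integral_abs => /(_ measurableT).
have mff : measurable_fun setT (fun x => (f x * f x)%:E).
  by apply/measurable_EFinP; exact: Linf_measurable.
move=> /(_ mff); apply: filterS => x /= /(_ I) [] /eqP.
by rewrite mulf_eq0 orbb => /eqP.
Qed.

End essentially_bounded.

(** * Almost-everywhere comparison and integrals *)

Section almost_everywhere.
Context (R : realType) (d : measure_display) (T : measurableType d).
Variable mu : probability T R.
Implicit Types f g : T -> R.

(** On the set where [g < f] the difference [f - g] is positive, yet by hypothesis its integral
    there is at most 0; so that set is null. *)
Lemma ae_le_Rintegral f g : mu.-integrable setT (EFin \o f) ->
  mu.-integrable setT (EFin \o g) ->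
  (forall A, measurable A -> \int[mu]_(x in A) f x <= \int[mu]_(x in A) g x) ->
  \forall x \ae mu, f x <= g x.
Proof.
move=> fi gi fg.
have mf : measurable_fun setT f by exact/measurable_EFinP/(measurable_int mu).
have mg : measurable_fun setT g by exact/measurable_EFinP/(measurable_int mu).
pose A := [set x | g x < f x].
have mA : measurable A.
  have := measurable_fun_ltr mg mf measurableT (Y := [set true]) I.
  by rewrite setTI.
have iA h : mu.-integrable setT (EFin \o h) -> mu.-integrable A (EFin \o h).
  by move=> ih; exact: integrableS ih.
have mfg : measurable_fun A (fun x => (f x - g x)%:E).
  by apply/measurable_EFinP/measurable_funB; exact: measurable_funTS.
have : (\int[mu]_(x in A) `|(f x - g x)%:E| = 0)%E.
  have -> : (\int[mu]_(x in A) `|(f x - g x)%:E| =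
      \int[mu]_(x in A) (f x - g x)%:E)%E.
    apply: eq_integral => x; rewrite inE => Ax /=.
    by rewrite ger0_norm// subr_ge0 ltW.
  rewrite -[LHS]fineK; last first.
    by apply: integrable_fin_num => //; exact: integrableB (iA _ fi) (iA _ gi).
  congr EFin; apply/eqP; rewrite eq_le.
  rewrite -/(Rintegral mu A (fun x => f x - g x)); apply/andP; split.
    by rewrite RintegralB ?subr_le0 ?fg//; exact: iA.
  by apply: Rintegral_ge0 => x /ltW; rewrite subr_ge0.
move/(ae_eq_integral_abs mu mA mfg); apply: filterS => x /= Ax.
rewrite leNgt; apply/negP => /[dup] xA /Ax [] /eqP.
by rewrite subr_eq0 => /eqP fgx; move: xA; rewrite fgx ltxx.
Qed.

Lemma ae_eq_Rintegral f g A : measurable A -> measurable_fun setT f ->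
  measurable_fun setT g -> f = g %[ae mu] ->
  \int[mu]_(x in A) f x = \int[mu]_(x in A) g x.
Proof.
move=> mA mf mg fg; congr fine; apply: ae_eq_integral => //.
- by apply/measurable_EFinP; exact: measurable_funTS.
- by apply/measurable_EFinP; exact: measurable_funTS.
- by apply: filterS fg => x /= fgx Ax; rewrite fgx.
Qed.

End almost_everywhere.

(** * Regression along a measurable map *)

Section regression.
Context (R : realType) (d : measure_display) (T : measurableType d).
Variable mu : probability T R.
Implicit Types f g : T -> R.

(** Truncation turns an almost-everywhere bound by [M] into a pointwise one, changing the function
    only on a null set. *)
Definition clamp (M y : R) : R := Num.max (- M) (Num.min M y).

Lemma measurable_clamp M : measurable_fun setT (clamp M).
Proof. by apply: measurable_maxr => //; exact: measurable_minr. Qed.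

Lemma norm_clamp M y : 0 <= M -> `|clamp M y| <= M.
Proof.
move=> M0; rewrite ler_norml /clamp; apply/andP; split.
  by rewrite le_max lexx.
by rewrite ge_max ge_min lexx andbT; lra.
Qed.

Lemma clamp_id M y : `|y| <= M -> clamp M y = y.
Proof.
rewrite ler_norml /clamp => /andP[yM My].
by rewrite (min_idPr My) (max_idPr yM).
Qed.

(** [phi] is the Radon-Nikodym derivative of the image under [p] of the measure with density [f],
    relative to the law of [p], then truncated. Having it on the target [T'] serves two uses: [p]
    the identity onto a smaller sigma-algebra gives conditional expectations, and [p] an iterate of
    [eta 0] gives the density of a pushed event. *)
Lemma bounded_regression d' (T' : measurableType d') (p : T -> T') f :
  measurable_fun setT p -> f \in Lfun mu +oo%E ->
  exists phi : T' -> R,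
    [/\ measurable_fun setT phi, exists M, forall y, `|phi y| <= M &
        forall A : set T', measurable A ->
          \int[mu]_(x in p @^-1` A) phi (p x) = \int[mu]_(x in p @^-1` A) f x].
Proof.
move=> mp Lf; have fi := Linf_integrable measurableT Lf.
have [mf [M0 fM0]] := (LinfP mu f).1 Lf.
pose M := `|M0|; have M_ge0 : 0 <= M by exact: normr_ge0.
have fM : \forall x \ae mu, `|f x| <= M.
  by apply: filterS fM0 => x fx; exact: le_trans fx (ler_norm _).
pose P : {mfun T >-> T'} := HB.pack p (isMeasurableFun.Build _ _ _ _ p mp).
pose mu' : probability T' R := distribution mu P.
(* [pose] abstracts over the measurability proof required by the instance. *)
pose nu_of : {charge set T' -> \bar R} := pushforward (induced_charge fi) P.
pose nu := nu_of mp.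
have mpA A : measurable A -> measurable (p @^-1` A).
  by move=> mA; have := mp measurableT _ mA; rewrite setTI.
have numu : nu `<< mu'.
  apply/null_content_dominatesP => A mA A0.
  apply: (null_set_integral (mpA _ mA)) => //.
  by apply/measurable_EFinP; exact: measurable_funTS.
pose phi0 := fine \o Radon_Nikodym nu mu'.
have phi0E : EFin \o phi0 = Radon_Nikodym nu mu'.
  by apply/funext => y; rewrite /= fineK// Radon_Nikodym_fin_num.
have phi0i : mu'.-integrable setT (EFin \o phi0).
  by rewrite phi0E; exact: Radon_Nikodym_integrable.
have intphi0 A : measurable A ->
    \int[mu']_(y in A) phi0 y = \int[mu]_(x in p @^-1` A) f x.
  move=> mA; congr fine; rewrite -[RHS]/(nu A) (Radon_Nikodym_integral numu mA).
  by rewrite -phi0E.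
have cst_i (c : R) : mu'.-integrable setT (EFin \o cst c).
  exact: finite_measure_integrable_cst.
have intcst (c : R) A : measurable A ->
    \int[mu']_(y in A) c = \int[mu]_(x in p @^-1` A) c.
  by move=> mA; rewrite !Rintegral_cst//; exact: mpA.
(* Monotonicity of the integral is applied with pointwise bounds, so [f] is truncated first. *)
have intf A : measurable A -> \int[mu]_(x in p @^-1` A) f x =
    \int[mu]_(x in p @^-1` A) clamp M (f x).
  move=> mA; apply: ae_eq_Rintegral => //; first exact: mpA.
    by apply: measurableT_comp => //; exact: measurable_clamp.
  by apply: filterS fM => x fx _; rewrite clamp_id.
have Lcf : (fun x => clamp M (f x)) \in Lfun mu +oo%E.
  apply: (@Linf_bounded _ _ _ mu _ M) => [|x]; last exact: norm_clamp.
  by apply: measurableT_comp => //; exact: measurable_clamp.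
have phi0_le : \forall y \ae mu', phi0 y <= M.
  apply: (@ae_le_Rintegral _ _ _ _ _ (cst M)) => // A mA.
  rewrite intphi0// intf// intcst//; apply: le_Rintegral.
  - exact: mpA.
  - by apply: Linf_integrable => //; exact: mpA.
  - by apply: Linf_integrable; [exact: mpA|exact: Linf_cst].
  - by move=> x _; have := norm_clamp (f x) M_ge0; rewrite ler_norml => /andP[].
have phi0_ge : \forall y \ae mu', - M <= phi0 y.
  apply: (@ae_le_Rintegral _ _ _ _ (cst (- M))) => // A mA.
  rewrite intphi0// intf// intcst//; apply: le_Rintegral.
  - exact: mpA.
  - by apply: Linf_integrable; [exact: mpA|exact: Linf_cst].
  - by apply: Linf_integrable => //; exact: mpA.
  - by move=> x _; have := norm_clamp (f x) M_ge0; rewrite ler_norml => /andP[].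
have mphi0 : measurable_fun setT phi0.
  by apply/measurable_EFinP/(measurable_int mu').
have mphi : measurable_fun setT (clamp M \o phi0).
  by apply: measurableT_comp => //; exact: measurable_clamp.
exists (clamp M \o phi0); split => //.
  by exists M => y; exact: norm_clamp.
move=> A mA; rewrite -intphi0//.
transitivity (\int[mu']_(y in A) (clamp M \o phi0) y).
  rewrite /Rintegral (integral_pushforward mp)//; first exact/measurable_EFinP.
  apply: (@Linf_integrable _ _ _ mu ((clamp M \o phi0) \o p)); first exact: mpA.
  apply: (@Linf_bounded _ _ _ mu _ M) => [|x]; last exact: norm_clamp.
  exact: measurableT_comp.
apply: ae_eq_Rintegral => //; apply: filterS2 phi0_le phi0_ge => y ? ? _.
by rewrite /= clamp_id// ler_norml; apply/andP.
Qed.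

End regression.

(** * Orthogonality and conditional expectations *)

Section conditioning.
Context (R : realType) (d : measure_display) (T : measurableType d).
Variable mu : probability T R.
Implicit Types (f g u v : T -> R) (A : set T) (G : set (set T)).

(** The exceptional null set of the bound pulls back to a null set. *)
Lemma Linf_comp h f : preserves mu h -> f \in Lfun mu +oo%E ->
  (f \o h) \in Lfun mu +oo%E.
Proof.
move=> [mh ph] /LinfP[mf [M fM]]; apply/LinfP; split.
  exact: measurableT_comp.
have mB : measurable [set x | `|f x| <= M].
  have mnf : measurable_fun setT (fun x => `|f x|) by exact: measurableT_comp.
  by have := measurable_fun_ler mnf (measurable_cst M) measurableT
    (Y := [set true]) I; rewrite setTI.
have mC := measurableC mB.
have B0 : mu (~` [set x | `|f x| <= M]) = 0%E by apply/negligibleP.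
exists M; apply/negligibleP; last by rewrite -B0 -(ph _ mC).
by have := mh measurableT _ mC; rewrite setTI.
Qed.

Lemma Rintegral_preserves h f A : preserves mu h -> f \in Lfun mu +oo%E ->
  measurable A -> \int[mu]_(x in h @^-1` A) f (h x) = \int[mu]_(x in A) f x.
Proof.
move=> ph Lf mA; have [mh hE] := ph.
have mhA := preserves_measurable ph mA.
congr fine; rewrite -(@integral_pushforward _ _ _ _ _ _ mh mu A (EFin \o f))//.
- by apply: eq_measure_integral => B mB _; exact: hE.
- by apply/measurable_EFinP; exact: Linf_measurable Lf.
- by apply: (Linf_integrable mhA); exact: Linf_comp Lf.
Qed.

Lemma ae_eq_indic A B : measurable A -> measurable B -> mu (A `+` B) = 0%E ->
  (\1_A : T -> R) = \1_B %[ae mu].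
Proof.
move=> mA mB AB0; exists (A `+` B); split=> //; first exact: measurable_setY.
move=> x /not_implyP[_ fAB]; apply: contrapT => nAB; apply: fAB.
suff AB : (x \in A) = (x \in B) by rewrite /= !indicE AB.
move: nAB; rewrite setY_def /setU /setD/= => nAB.
by apply/idP/idP; rewrite !inE => Hx; apply: contrapT => nHx; tauto.
Qed.

Lemma Rintegral_setY_null f A B : f \in Lfun mu +oo%E ->
  measurable A -> measurable B -> mu (A `+` B) = 0%E ->
  \int[mu]_(x in A) f x = \int[mu]_(x in B) f x.
Proof.
move=> Lf mA mB AB0.
rewrite -[LHS]RintegralM_indic -[RHS]RintegralM_indic.
apply: ae_eq_Rintegral => //.
- exact: Linf_measurable (LinfM Lf (Linf_indic mu mA)).
- exact: Linf_measurable (LinfM Lf (Linf_indic mu mB)).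
by apply: filterS (ae_eq_indic mA mB AB0) => x /(_ I) ABx _; rewrite ABx.
Qed.

Lemma Linfty_comp G u (c : R -> R) M : measurable_fun setT c ->
  (forall y, `|c y| <= M) -> Linfty mu G u -> Linfty mu G (c \o u).
Proof.
move=> mc cM [Lu uG]; split; last first.
  by apply: subset_trans uG; exact: preimage_set_system_compS.
apply: (@Linf_bounded _ _ _ _ _ M) => [|x]; last exact: cM.
exact: measurableT_comp mc (Linf_measurable Lu).
Qed.

Lemma Linfty_preimage G u (Y : set R) :
  Linfty mu G u -> measurable Y -> G (u @^-1` Y).
Proof. by move=> [_ uG] mY; apply: uG; exists Y => //; rewrite setTI. Qed.

(** The sum counts the integers from 1 to [N] that are at most [y]: it is the integer part of [y]
    capped at [N]. The first conjunct carries the induction for the second. *)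
Lemma layer_sum_approx (y : R) (N : nat) : 0 <= y ->
  (N%:R <= y -> \sum_(k < N) (k.+1%:R <= y)%R%:R = N%:R :> R) /\
  (y <= N%:R -> `|y - \sum_(k < N) (k.+1%:R <= y)%R%:R| <= 1).
Proof.
move=> y0; elim: N => [|N [IH1 IH2]].
  by rewrite big_ord0; split => // y_le0; rewrite subr0 ger0_norm//; lra.
rewrite big_ord_recr/=; split=> [Ny|yN].
  by rewrite IH1 ?Ny ?natr1//; apply: le_trans Ny; rewrite ler_nat.
have [Ny|Ny] := leP N.+1%:R y.
  have -> : y = N.+1%:R by apply/eqP; rewrite eq_le Ny yN.
  have := IH1; have -> : y = N.+1%:R by apply/eqP; rewrite eq_le Ny yN.
  by rewrite ler_nat leqnSn => ->//; rewrite natr1 subrr normr0.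
rewrite addr0; have [/IH2//|/ltW/[dup] Ny' /IH1 ->] := leP y N%:R.
by rewrite ger0_norm ?subr_ge0// lerBlDr addrC natr1 ltW.
Qed.

(* [u] is within 1 of the sum of the indicators of the sets [u >= k.+1], over
   which [f] has zero integral. *)
Lemma norm_Rintegral_layers G f u (N : nat) : f \in Lfun mu +oo%E ->
  Linfty mu G u -> (forall x, 0 <= u x <= N%:R) ->
  (forall A, G A -> \int[mu]_(x in A) f x = 0) ->
  `|\int[mu]_x (f x * u x)| <= \int[mu]_x `|f x|.
Proof.
move=> Lf Gu uN f0; have [Lu _] := Gu.
pose A k := u @^-1` [set y | k.+1%:R <= y].
have mS (k : nat) : measurable [set y : R | k.+1%:R <= y].
  have := @measurable_fun_ler _ _ R setT (cst k.+1%:R) id (measurable_cst _)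
    (@measurable_id _ _ setT) measurableT [set true] I.
  by rewrite setTI.
have GA k : G (A k) by exact: Linfty_preimage.
have mA k : measurable (A k).
  by have := Linf_measurable Lu measurableT (mS k); rewrite setTI.
pose S n x := \sum_(k < n) \1_(A k) x : R.
have LS0 n : S n \in Lfun mu +oo%E /\ \int[mu]_x (f x * S n x) = 0.
  elim: n => [|n [LS IH]].
    have -> : S 0%N = fun=> 0 by apply/funext => x; rewrite /S big_ord0.
    split; first exact: Linf_cst.
    under eq_Rintegral do rewrite mulr0.
    by rewrite Rintegral_cst// mul0r.
  have -> : S n.+1 = fun x => S n x - (- \1_(A n) x).
    by apply/funext => x; rewrite opprK /S big_ord_recr.
  have LA : (fun x => - \1_(A n) x) \in Lfun mu +oo%E.
    have -> : (fun x => - \1_(A n) x : R) = (fun x => 0 - \1_(A n) x).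
      by apply/funext => x; rewrite sub0r.
    by apply: LinfB; [exact: Linf_cst|exact: Linf_indic].
  split; first exact: LinfB.
  under eq_Rintegral do rewrite mulrBr mulrN opprK.
  have -> : \int[mu]_x (f x * S n x + f x * \1_(A n) x) =
      \int[mu]_x (f x * S n x) + \int[mu]_x (f x * \1_(A n) x).
    by apply: RintegralD => //; apply: Linf_integrable => //; apply: LinfM => //;
      exact: Linf_indic.
  by rewrite IH add0r RintegralM_indic f0.
have LS n := (LS0 n).1; have S0 n := (LS0 n).2.
have Lfabs : (fun x => `|f x|) \in Lfun mu +oo%E.
  have [mf [M fM]] := (LinfP mu f).1 Lf; apply/LinfP; split.
    exact: measurableT_comp.
  by exists M; apply: filterS fM => x; rewrite normr_id.
have LuS := LinfB Lu (LS N).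
(* As [f] is orthogonal to [S N], only the remainder contributes, and it is at most 1 in absolute
   value. *)
have -> : \int[mu]_x (f x * u x) = \int[mu]_x (f x * (u x - S N x)).
  under [RHS]eq_Rintegral do rewrite mulrBr.
  rewrite RintegralB//; [|exact: Linf_integrable (LinfM Lf _)..].
  by rewrite S0 subr0.
apply: le_trans (le_normr_Rintegral _ _) _ => //.
  exact: Linf_integrable (LinfM Lf LuS).
have LfuS := LinfM Lf LuS.
apply: le_Rintegral => //.
- by apply: integrable_norm => //; exact: Linf_integrable.
- exact: Linf_integrable.
move=> x _; rewrite normrM ler_piMr//.
have /andP[ux0 uxN] := uN x.
have := (layer_sum_approx N ux0).2 uxN; congr (`|_ - _| <= _).
apply: eq_bigr => k _; rewrite indicE; congr (_%:R).
by congr nat_of_bool; apply/idP/idP; rewrite inE.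
Qed.

(** A scaling argument: the layer bound for arbitrarily large multiples of one function is a fixed
    constant, which forces the integral to vanish. Conditional expectations can then be handled as
    orthogonal projections. *)
Lemma Rintegral_mul_eq0 G f u : f \in Lfun mu +oo%E -> Linfty mu G u ->
  (forall A, G A -> \int[mu]_(x in A) f x = 0) -> \int[mu]_x (f x * u x) = 0.
Proof.
move=> Lf Gu f0; have [Lu _] := Gu; have [mu_ [M0 uM0]] := (LinfP mu u).1 Lu.
pose M := `|M0|; have M_ge0 : 0 <= M by exact: normr_ge0.
have uM : \forall x \ae mu, `|u x| <= M.
  by apply: filterS uM0 => x ux; exact: le_trans ux (ler_norm _).
have GT : G setT.
  by have := Linfty_preimage Gu measurableT; rewrite preimage_setT.
(* The shift by [M] makes the function nonnegative, and costs nothing because [f] has zero integral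
   over the whole space. *)
pose v x := clamp M (u x) + M.
have v_ge0 x : 0 <= v x <= 2 * M.
  by have := norm_clamp (u x) M_ge0; rewrite ler_norml /v => /andP[]; lra.
have Gv (m : nat) : Linfty mu G (fun x => m%:R * v x).
  apply: (@Linfty_comp G u (fun y => m%:R * (clamp M y + M))
    (m%:R * (2 * M))) => //.
    apply: measurable_funM => //; apply: measurable_funD => //.
    exact: measurable_clamp.
  move=> y; have := norm_clamp y M_ge0; rewrite ler_norml => /andP[? ?].
  by rewrite ger0_norm ?mulr_ge0 ?ler_wpM2l//; lra.
have Lv : v \in Lfun mu +oo%E.
  suff <- : (fun x => 1%:R * v x) = v by case: (Gv 1%N).
  by apply/funext => x; rewrite mul1r.
have -> : \int[mu]_x (f x * u x) = \int[mu]_x (f x * v x).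
  transitivity (\int[mu]_x (f x * v x - f x * M)).
    apply: ae_eq_Rintegral => //.
    - exact: Linf_measurable (LinfM Lf Lu).
    - exact: Linf_measurable (LinfB (LinfM Lf Lv) (LinfM Lf (Linf_cst mu M))).
    - by apply: filterS uM => x ux _; rewrite /v clamp_id// mulrDr addrK.
  rewrite RintegralB//; last 2 first.
  - exact: Linf_integrable (LinfM Lf Lv).
  - exact: Linf_integrable (LinfM Lf (Linf_cst mu M)).
  by rewrite RintegralZr ?f0 ?mul0r ?subr0//; exact: Linf_integrable.
(* The layer bound does not depend on the scale [m]. *)
have bound (m : nat) :
    m%:R * `|\int[mu]_x (f x * v x)| <= \int[mu]_x `|f x|.
  have [N mN] : exists N : nat, m%:R * (2 * M) <= N%:R.
    exists (Num.truncn (m%:R * (2 * M))).+1; exact/ltW/truncnS_gt.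
  have mvN x : 0 <= m%:R * v x <= N%:R.
    have /andP[v0 vM] := v_ge0 x; rewrite mulr_ge0//=.
    by apply: le_trans mN; rewrite ler_wpM2l.
  have := norm_Rintegral_layers Lf (Gv m) mvN f0; apply: le_trans.
  under [X in _ <= `|X|]eq_Rintegral do rewrite mulrCA.
  rewrite RintegralZl ?normrM ?normr_nat//.
  exact: Linf_integrable (LinfM Lf Lv).
apply/eqP; apply: contraT; rewrite -normr_gt0 => I0.
(* This scale exceeds the quotient of the two integrals, against [bound]. *)
have /= := bound (Num.truncn ((\int[mu]_x `|f x|) / `|\int[mu]_x (f x * v x)|)).+1.
by rewrite leNgt -ltr_pdivrMr// truncnS_gt.
Qed.

Lemma is_condexpP G f g : f \in Lfun mu +oo%E -> G `<=` measurable ->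
  is_condexp mu G f g <-> Linfty mu G g /\
    forall A, G A -> \int[mu]_(x in A) g x = \int[mu]_(x in A) f x.
Proof.
move=> Lf mG; split=> -[Gg gf]; split=> // A GA.
  by congr fine; exact: gf.
have mA := mG _ GA; have [Lg _] := Gg.
rewrite -[LHS]fineK ?(integrable_fin_num mA) ?Linf_integrable//.
rewrite -[RHS]fineK ?(integrable_fin_num mA) ?Linf_integrable//.
by congr EFin; exact: gf.
Qed.

(** The difference of two versions is orthogonal to each of them, hence to itself. *)
Lemma is_condexp_unique G f g1 g2 : f \in Lfun mu +oo%E -> G `<=` measurable ->
  is_condexp mu G f g1 -> is_condexp mu G f g2 -> g1 = g2 %[ae mu].
Proof.
move=> Lf mG /(is_condexpP _ Lf mG)[Gg1 g1f] /(is_condexpP _ Lf mG)[Gg2 g2f].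
have [[L1 _] [L2 _]] := (Gg1, Gg2); have L12 := LinfB L1 L2.
have g12 A : G A -> \int[mu]_(x in A) (g1 x - g2 x) = 0.
  move=> GA; have mA := mG _ GA.
  by rewrite RintegralB ?g1f ?g2f ?subrr//; exact: Linf_integrable.
have : \int[mu]_x ((g1 x - g2 x) * (g1 x - g2 x)) = 0.
  under eq_Rintegral do rewrite mulrBr.
  rewrite RintegralB//; [|exact: Linf_integrable (LinfM L12 _)..].
  by rewrite (Rintegral_mul_eq0 L12 Gg1) ?(Rintegral_mul_eq0 L12 Gg2) ?subrr.
move/(Rintegral_sqr_eq0 L12); apply: filterS => x /= /(_ I) /eqP.
by rewrite subr_eq0 => /eqP.
Qed.

(** Existence comes from regression along the identity from [T] to [T] equipped with [G]:
    measurability on that target is measurability for [G]. *)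
Lemma condexpP G f : f \in Lfun mu +oo%E -> sigma_algebra setT G ->
  G `<=` measurable -> is_condexp mu G f (condexp mu G f).
Proof.
move=> Lf sG mG.
have GE : <<s G >> = G by exact: sigma_algebra_id.
pose p : T -> g_sigma_algebraType G := id.
have mp : measurable_fun setT p.
  by move=> _ Y; rewrite setTI /p /measurable/= GE => /mG.
have [phi [mphi [M phiM] phiE]] := bounded_regression mp Lf.
have Gphi Y : measurable Y -> G (phi @^-1` Y).
  by move=> mY; have := mphi measurableT _ mY; rewrite setTI /measurable/= GE.
apply: (@xgetPex _ (cst 0) (is_condexp mu G f)); exists phi.
apply/is_condexpP => //; split; last first.
  by move=> A GA; apply: phiE; rewrite /measurable/= GE.
split; last by move=> A [Y mY <-]; rewrite setTI; exact: Gphi.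
apply: (@Linf_bounded _ _ T mu (phi : T -> R) M) phiM => _ Y mY.
by rewrite setTI; exact/mG/Gphi.
Qed.

End conditioning.

(** * Transport along a measure-preserving map *)

Section pullback.
Context (R : realType) (d : measure_display) (T : measurableType d).
Variable mu : probability T R.
Implicit Types (A B C : set T) (F G : set (set T)) (f phi : T -> R).

Lemma Linfty_indic G A : sigma_algebra setT G -> G `<=` measurable -> G A ->
  Linfty mu G \1_A.
Proof.
move=> [G0 GC GU] mG GA; split; first exact/Linf_indic/mG.
have GT : G setT by have := GC _ G0; rewrite setD0.
move=> _ [Y _ <-]; rewrite setTI preimage_indic.
have GnA : G (~` A) by rewrite -setTD; exact: GC.
by case: ifP => _; case: ifP.
Qed.

(* If [phi] dmu is invariant under [h], then [phi - phi \o h] is orthogonal to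
   [phi \o h], and [phi], [phi \o h] have the same L^2-norm. *)
Lemma ae_invariant_density h phi : preserves mu h -> phi \in Lfun mu +oo%E ->
  (forall A, measurable A ->
    \int[mu]_(x in h @^-1` A) phi x = \int[mu]_(x in A) phi x) ->
  phi = phi \o h %[ae mu].
Proof.
move=> ph Lphi phiE; have Lh := Linf_comp ph Lphi.
pose G := g_sigma_algebra_preimage h.
have Lf := LinfB Lphi Lh.
have f0 A : G A -> \int[mu]_(x in A) (phi x - (phi \o h) x) = 0.
  move=> [C mC <-]; rewrite setTI.
  have mhC := preserves_measurable ph mC.
  rewrite RintegralB ?phiE ?Rintegral_preserves ?subrr//;
    exact: Linf_integrable.
have Gh : Linfty mu G (phi \o h).
  split => //; apply: preimage_set_system_compS.
  exact: Linf_measurable Lphi.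
have f_orth := Rintegral_mul_eq0 Lf Gh f0.
have i (a b : T -> R) : a \in Lfun mu +oo%E -> b \in Lfun mu +oo%E ->
    mu.-integrable setT (EFin \o (fun x => a x * b x)).
  by move=> La Lb; exact: Linf_integrable (LinfM La Lb).
have sq : \int[mu]_x ((phi \o h) x * (phi \o h) x) = \int[mu]_x (phi x * phi x).
  by have := Rintegral_preserves ph (LinfM Lphi Lphi) measurableT;
    rewrite preimage_setT.
have cross : \int[mu]_x (phi x * (phi \o h) x) = \int[mu]_x (phi x * phi x).
  apply/eqP; rewrite -[X in _ == X]sq -subr_eq0 -RintegralB//; [|exact: i..].
  by under eq_Rintegral do rewrite -mulrBl; apply/eqP.
have : \int[mu]_x ((phi x - (phi \o h) x) * (phi x - (phi \o h) x)) = 0.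
  under eq_Rintegral do rewrite mulrBr.
  rewrite RintegralB//; [|exact: i..]; rewrite f_orth subr0.
  under eq_Rintegral do rewrite mulrBl [_ (h _) * _]mulrC.
  by rewrite RintegralB//; [rewrite cross subrr|exact: i..].
move/(Rintegral_sqr_eq0 Lf); apply: filterS => x /= /(_ I) /eqP.
by rewrite subr_eq0 => /eqP phix _.
Qed.

Lemma preimage_completed_sigma h F F' A : preserves mu h ->
  (forall C, F C -> completed_sigma mu F' (h @^-1` C)) ->
  completed_sigma mu F A -> completed_sigma mu F' (h @^-1` A).
Proof.
move=> ph FF'; have [G0 GC GU] := sigma_algebra_completed mu F'.
apply: (@completed_sigma_sub _ _ _ _ _
  [set A | completed_sigma mu F' (h @^-1` A)]) => //.
- split => //= [C hC|C hC].
    by rewrite setTD preimage_setC -setTD; exact: GC.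
  by rewrite preimage_bigcup; exact: GU.
- move=> N mN N0; apply: completed_sigma_null; last by rewrite ph.2.
  exact: preserves_measurable ph mN.
Qed.

(** The conclusion holds only up to a null set, because a null set adjoined by the completion need
    not be a preimage under [h]; it is matched with the empty set. *)
Lemma completed_sigma_pullback h F F' A : preserves mu h ->
  F `<=` measurable ->
  (forall C, F' C -> exists2 C', F C' & C = h @^-1` C') ->
  completed_sigma mu F' A ->
  exists2 A', completed_sigma mu F A' & mu (A `+` h @^-1` A') = 0%E.
Proof.
move=> ph mF F'F.
have [G0 GC GU] := sigma_algebra_completed mu F.
have mG := completed_sigma_measurable (mu := mu) mF.
pose G := [set A | measurable A /\
  exists2 A', completed_sigma mu F A' & mu (A `+` h @^-1` A') = 0%E].
suff : completed_sigma mu F' `<=` G by move=> H /H[].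
apply: completed_sigma_sub.
- split => [|C [mC [C' FC' CC']]|C GC_].
  + by split => //; exists set0; rewrite ?preimage_set0 ?setYK ?measure0.
  + rewrite setTD; split; first exact: measurableC.
    exists (setT `\` C'); first exact: GC.
    by rewrite setTD preimage_setC setYCC.
  + have mC k : measurable (C k) by have [] := GC_ k.
    have /choice[C' C'P] : forall k, exists C',
        completed_sigma mu F C' /\ mu (C k `+` h @^-1` C') = 0%E.
      by move=> k; have [_ [C' ? ?]] := GC_ k; exists C'.
    have mhC' k : measurable (h @^-1` C' k).
      exact: preserves_measurable ph (mG _ (C'P k).1).
    split; first exact: bigcupT_measurable.
    exists (\bigcup_k C' k); first by apply: GU => k; exact: (C'P k).1.
    rewrite preimage_bigcup.
    apply: (subset_measure0 (mu := mu) _ _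
      (@setY_bigcup_subset _ C (fun k => h @^-1` C' k))).
    * by apply: measurable_setY; exact: bigcupT_measurable.
    * by apply: bigcupT_measurable => k; exact: measurable_setY.
    * apply: measure_bigcup_null => k; first exact: measurable_setY.
      exact: (C'P k).2.
- move=> C /F'F[C' FC' ->]; split.
    exact: preserves_measurable ph (mF _ FC').
  by exists C'; [exact: completed_sigma_gen|rewrite setYK measure0].
- move=> N mN N0; split => //; exists set0 => //.
  by rewrite preimage_set0 setY0.
Qed.

End pullback.

(** * Consequences of the Thompson monoid relations; stationarity *)

Section partial_spreadability.
Context (R : realType) (d d0 : measure_display).
Context (T : measurableType d) (T0 : measurableType d0).
Variable mu : probability T R.
Context (xi : nat -> {RV mu >-> T0}) (eta : nat -> {mfun T >-> T}).
Context (spread : partially_spreadable xi eta).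

Lemma preserves_implementation k : preserves mu (eta k).
Proof.
split; first exact: measurable_funP.
by move=> A mA; exact: (implementation_preserving spread).
Qed.

Lemma preserves_shift n : preserves mu (iter n (eta 0%N)).
Proof. exact/preserves_iter/preserves_implementation. Qed.

(** Each move of [eta l] past one copy of [eta k] raises its index by one. *)
Lemma implementation_iter k l m x : (k < l)%N ->
  eta l (iter m (eta k) x) = iter m (eta k) (eta (l + m)%N x).
Proof.
elim: m l => [|m IH] l kl; first by rewrite addn0.
rewrite !iterS.
have /= -> := implementation_relations spread kl (iter m (eta k) x).
by rewrite IH ?addSnnS//; exact: ltnW.
Qed.

Lemma RV_shift m n x : xi (m + n)%N x = xi m (iter n (eta 0%N) x).
Proof. by rewrite !(implementation_stationary spread) /= iterD. Qed.

(** Write [xi i] as [xi 0] after [i] copies of [eta 0]. Moving [eta k] out of these lowers its index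
    to [k - i], still positive, and [xi 0] absorbs it. *)
Lemma RV_fixed i k x : (i < k)%N -> xi i (eta k x) = xi i x.
Proof.
move=> ik; rewrite !(implementation_stationary spread) /=.
have k_i : (0 < k - i)%N by rewrite subn_gt0.
rewrite -{1}(subnK (ltnW ik)) -implementation_iter//.
by rewrite [RHS](implementation_localized spread k_i).
Qed.

(** The shifted sequence is the original one composed with an iterate of [eta 0], which preserves
    [mu]. *)
Lemma stationary_of_spread : stationary_sequence xi.
Proof.
move=> n C _ sC.
have mC : measurable ((fun t i => xi i t) @^-1` C).
  pose G := [set C : set (nat -> T0) |
    measurable ((fun t i => xi i t) @^-1` C)].
  suff : @seq_sigma _ T0 `<=` G by apply.
  apply: smallest_sub => [|_ [i _ [Y mY <-]]].
    split => [|A|F].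
    - by rewrite /G /= preimage_set0.
    - by rewrite /G /= => mA; rewrite setTD preimage_setC; exact: measurableC.
    - rewrite /G /= => mF; rewrite preimage_bigcup.
      exact: bigcupT_measurable.
  by rewrite /G /= setTI; exact: measurable_funPTI.
rewrite -((preserves_shift n).2 _ mC); congr (mu _).
apply/seteqP; split=> x; rewrite /preimage /=; congr C;
  by apply/funext => i; rewrite addnC RV_shift.
Qed.

Let sigma_gen (I : set nat) := \bigcup_(i in I) g_sigma_algebra_preimage (xi i).

Lemma sigma_gen_measurable I : sigma_gen I `<=` measurable.
Proof.
by move=> _ [i _ [Y mY <-]]; rewrite setTI; exact: measurable_funPTI.
Qed.

Lemma sigma_rv_measurable I : sigma_rv mu xi I `<=` measurable.
Proof. exact/completed_sigma_measurable/sigma_gen_measurable. Qed.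

Lemma sigma_rvS I J : I `<=` J -> sigma_rv mu xi I `<=` sigma_rv mu xi J.
Proof. by move=> IJ; apply: completed_sigmaS => A [i /IJ Ji ?]; exists i. Qed.

(** Generating events are strictly invariant by [RV_fixed]; the completion weakens this to almost
    invariance. *)
Lemma sigma_rv_fixed n B : sigma_rv mu xi [set i | (i <= n)%N] B ->
  almost_invariant mu (eta n.+1) B.
Proof.
move=> nB; apply/almost_invariantP.
have pe := preserves_implementation n.+1.
move: B nB; apply: completed_sigma_sub.
- exact: sigma_algebra_asymptotically_invariant.
- move=> _ [i /= ni [Y mY <-]]; rewrite setTI; apply/almost_invariantP.
  split; first exact: measurable_funPTI.
  rewrite (_ : eta n.+1 @^-1` _ = xi i @^-1` Y) ?setYK ?measure0//.
  by apply/seteqP; split=> x; rewrite /preimage /= RV_fixed.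
- by move=> N mN N0; exact: null_asymptotically_invariant.
Qed.

Lemma sigma_rv_shift m n A : sigma_rv mu xi [set m] A ->
  sigma_rv mu xi [set (m + n)%N] (iter n (eta 0%N) @^-1` A).
Proof.
apply: preimage_completed_sigma; first exact: preserves_shift.
move=> _ [i /= -> [Y mY <-]]; apply: completed_sigma_gen.
exists (m + n)%N => //; exists Y => //; rewrite !setTI.
by apply/seteqP; split=> x; rewrite /preimage /= RV_shift.
Qed.

Lemma sigma_rv_unshift m n A : sigma_rv mu xi [set (m + n)%N] A ->
  exists2 A', sigma_rv mu xi [set m] A' &
    mu (A `+` iter n (eta 0%N) @^-1` A') = 0%E.
Proof.
apply: completed_sigma_pullback.
- exact: preserves_shift.
- exact: sigma_gen_measurable.
move=> _ [i /= -> [Y mY <-]]; exists (xi m @^-1` Y).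
  by exists m => //; exists Y => //; rewrite setTI.
by rewrite setTI; apply/seteqP; split=> x; rewrite /preimage /= RV_shift.
Qed.

(** * Invariant sets under the generating property *)

Section generating_property.
Context (gen : generating mu eta).

(** A set of J_n is almost [eta k]-invariant as soon as [k > n], and such sets generate all events
    up to completion. *)
Lemma generated_asymptotically_invariant A : measurable A ->
  asymptotically_invariant mu (fun k => eta k) A.
Proof.
rewrite -gen; move: A; apply: completed_sigma_sub.
- exact/sigma_algebra_asymptotically_invariant/preserves_implementation.
- move=> A [n _ nA]; split; first by have [] := nA n.+1 (ltnSn n).
  move=> e e0; near=> k; have [|_ ->] := nA k; last by rewrite lee_fin ltW.
  by near: k; exists n.+1.
- by move=> N mN N0; apply: null_asymptotically_invariant => //;
    exact: preserves_implementation.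
Unshelve. all: by end_near. Qed.

(* For [m] large, [A] is close to [eta (l + m)^-1 A], while [eta k^-m] maps
   [A `+` eta l^-1 A] almost onto [A `+` eta (l + m)^-1 A]. *)
Lemma almost_invariant_le k l A : (k < l)%N ->
  almost_invariant mu (eta k) A -> almost_invariant mu (eta l) A.
Proof.
move=> kl kA; have [mA _] := kA; split=> //.
have [_ asym] := generated_asymptotically_invariant mA.
have pk := preserves_implementation k; have pl j := preserves_implementation j.
have ml j := preserves_measurable (pl j) mA.
apply/eqP; rewrite -measure_le0; apply/lee_addgt0Pr => e e0; rewrite add0e.
have [m _ mAe] := asym e e0.
have mk := preserves_measurable (preserves_iter m pk) mA.
have kA0 := iter_almost_invariant m pk kA.
rewrite -[leLHS]((preserves_iter m pk).2 _ (measurable_setY mA (ml l))).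
rewrite preimage_setY.
have -> : iter m (eta k) @^-1` (eta l @^-1` A) =
    eta (l + m)%N @^-1` (iter m (eta k) @^-1` A).
  by apply/seteqP; split=> x; rewrite /preimage /= implementation_iter.
have mlk := preserves_measurable (pl (l + m)%N) mk.
apply: le_trans (measure_setY_triangle mu mk mA mlk) _.
rewrite setYC kA0 add0e.
apply: le_trans (measure_setY_triangle mu mA (ml (l + m)%N) mlk) _.
rewrite -[X in (_ + mu X)%E]preimage_setY (pl _).2; last exact: measurable_setY.
by rewrite kA0 adde0; apply: mAe => /=; exact: leq_addl.
Qed.

(** The intersection defining J_n collapses to its first term, since invariance passes to larger
    indices. *)
Lemma almost_invariant_fixed_sigma n A : almost_invariant mu (eta n.+1) A ->
  fixed_sigma mu eta n A.
Proof.
move=> nA k /=; rewrite leq_eqVlt => /predU1P[<-//|nk].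
exact: almost_invariant_le nk nA.
Qed.

(* [phi] is the conditional expectation of [\1_B] given [eta 0^n], as a function
   on the image; it is [eta 1]-invariant since [eta 1 \o eta 0^n] equals
   [eta 0^n \o eta n.+1]. *)
Lemma pushed_indicator n B : almost_invariant mu (eta n.+1) B ->
  exists2 phi : T -> R, Linfty mu (fixed_sigma mu eta 0) phi &
    forall A, measurable A ->
      \int[mu]_(x in iter n (eta 0%N) @^-1` A) \1_B x = \int[mu]_(x in A) phi x.
Proof.
move=> [mB nB]; set h := iter n (eta 0%N).
have ph : preserves mu h := preserves_shift n.
have LB : (\1_B : T -> R) \in Lfun mu +oo%E by exact: Linf_indic.
have [phi [mphi [M phiM] phiE]] := bounded_regression ph.1 LB.
have Lphi := Linf_bounded mu mphi phiM.
have phiP A : measurable A ->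
    \int[mu]_(x in h @^-1` A) \1_B x = \int[mu]_(x in A) phi x.
  by move=> mA; rewrite -phiE// Rintegral_preserves.
exists phi => //; split => // _ [Y mY <-]; rewrite setTI.
have mphiY : measurable (phi @^-1` Y).
  by have := mphi measurableT _ mY; rewrite setTI.
apply: almost_invariant_fixed_sigma; split => //.
have pe k := preserves_implementation k.
have inv : phi = phi \o eta 1%N %[ae mu].
  apply: ae_invariant_density => // A mA.
  have mhA := preserves_measurable ph mA.
  rewrite -phiP; last exact: preserves_measurable (pe _) mA.
  rewrite -phiP//.
  have -> : h @^-1` (eta 1%N @^-1` A) = eta n.+1 @^-1` (h @^-1` A).
    by apply/seteqP; split=> x; rewrite /preimage /= /h implementation_iter.
  have meB := preserves_measurable (pe n.+1) mB.
  (* Almost invariance of [B] puts [eta n.+1] inside the indicator, so that its preservation of [mu]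
     removes it from both places. *)
  transitivity (\int[mu]_(x in eta n.+1 @^-1` (h @^-1` A)) \1_B (eta n.+1 x)).
    apply: ae_eq_Rintegral.
    - exact: preserves_measurable (pe _) mhA.
    - exact: measurable_indic.
    - exact: measurableT_comp (measurable_indic _) (pe _).1.
    - exact: ae_eq_indic nB.
  exact: Rintegral_preserves.
(* The preimage of [Y] under [phi] and its own [eta 1]-preimage differ only inside the null set
   where [phi] and [phi \o eta 1] disagree. *)
have [N [mN N0 invN]] := inv.
have mephiY := preserves_measurable (pe 1%N) mphiY.
apply: (subset_measure0 (mu := mu) (measurable_setY mphiY mephiY) mN _ N0).
move=> x xY; apply: invN => /(_ I) /= phix; move: xY.
by rewrite setY_def /preimage /setU /setD /= -phix; tauto.
Qed.

(** * Conditional independence and the Markov property *)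

Section conditional_independence.
Context (indep : cond_independent mu (sigma_rv mu xi [set: nat])
  (fixed_sigma mu eta 0) (sigma_rv mu xi [set 0%N])).

Lemma sigma_algebra_rv I : sigma_algebra setT (sigma_rv mu xi I).
Proof. exact: sigma_algebra_completed. Qed.

Lemma sigma_rvT I : sigma_rv mu xi I setT.
Proof.
by have [S0 SC _] := sigma_algebra_rv I; rewrite -(setD0 setT); exact: SC.
Qed.

(** With E the expectation given xi_0 and [psi] = E[phi], conditional independence turns E[1_A phi]
    into E[1_A] [psi]; integrating, E[1_A] may be replaced by 1_A because [psi] is measurable for
    xi_0. *)
Lemma fixed_condexp phi : Linfty mu (fixed_sigma mu eta 0) phi ->
  exists2 psi : T -> R, Linfty mu (sigma_rv mu xi [set 0%N]) psi &
    forall A, sigma_rv mu xi setT A ->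
      \int[mu]_(x in A) phi x = \int[mu]_(x in A) psi x.
Proof.
move=> Jphi; have [Lphi _] := Jphi; set G0 := sigma_rv mu xi [set 0%N].
have sG0 : sigma_algebra setT G0 := sigma_algebra_rv _.
have mG0 : G0 `<=` measurable := @sigma_rv_measurable _.
have condexpE f : f \in Lfun mu +oo%E -> Linfty mu G0 (condexp mu G0 f) /\
    forall A, G0 A ->
      \int[mu]_(x in A) condexp mu G0 f x = \int[mu]_(x in A) f x.
  by move=> Lf; apply/is_condexpP => //; exact: condexpP.
have [Gpsi psiE] := condexpE _ Lphi; exists (condexp mu G0 phi) => // A SA.
have mA := sigma_rv_measurable SA.
have SA1 := Linfty_indic mu (sigma_algebra_rv _) (@sigma_rv_measurable setT) SA.
have [LA _] := SA1; have [LEpsi _] := Gpsi.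
have [[LEA _] EA] := condexpE _ LA.
have LAphi : \1_A \* phi \in Lfun mu +oo%E := LinfM LA Lphi.
have [[LEAphi _] EAphi] := condexpE _ LAphi.
rewrite -[LHS]RintegralM_indic -[RHS]RintegralM_indic.
transitivity (\int[mu]_x condexp mu G0 (\1_A \* phi) x).
  rewrite EAphi; last exact: sigma_rvT.
  by apply: eq_Rintegral => x _; rewrite /= mulrC.
transitivity (\int[mu]_x (condexp mu G0 \1_A x * condexp mu G0 phi x)).
  apply: ae_eq_Rintegral => //.
  - exact: Linf_measurable LEAphi.
  - exact: Linf_measurable (LinfM LEA LEpsi).
  - exact: indep.
under [RHS]eq_Rintegral do rewrite mulrC.
apply/eqP; rewrite -subr_eq0 -RintegralB//;
  [|by apply: Linf_integrable => //; exact: LinfM..].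
under eq_Rintegral do rewrite -mulrBl.
apply/eqP; apply: (Rintegral_mul_eq0 (LinfB LEA LA) Gpsi) => C GC.
have mC := mG0 _ GC.
by rewrite RintegralB ?EA ?subrr//; exact: Linf_integrable.
Qed.

(** Up to a null set [A] is the [h]-preimage of an event of xi_m, where the density [phi] and its
    expectation have equal integrals. One [psi] serves all [m]; the Markov property compares [m = 0]
    with [m = 1]. *)
Lemma indicator_orthogonal n B : almost_invariant mu (eta n.+1) B ->
  exists2 psi : T -> R, Linfty mu (sigma_rv mu xi [set n]) psi &
    forall m A, sigma_rv mu xi [set (m + n)%N] A ->
      \int[mu]_(x in A) (\1_B x - psi x) = 0.
Proof.
move=> nB; have [mB _] := nB; have LB := Linf_indic mu mB.
have [phi /fixed_condexp[psi Gpsi psiE] phiE] := pushed_indicator nB.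
set h := iter n (eta 0%N) in phiE *.
have ph : preserves mu h := preserves_shift n.
have [Lpsi psiG] := Gpsi; have Lpsih := Linf_comp ph Lpsi.
exists (psi \o h).
  (* Writing [n] as [0 + n] presents the set as an event of xi_0 shifted by [n]. *)
  split => // _ [Y mY <-]; rewrite setTI comp_preimage -[n]add0n.
  by apply: sigma_rv_shift; exact: Linfty_preimage Gpsi mY.
move=> m A mnA; have mA := sigma_rv_measurable mnA.
have [A' mA' AA'] := sigma_rv_unshift mnA.
have SA' : sigma_rv mu xi setT A' by exact: sigma_rvS mA'.
have mA'_ := sigma_rv_measurable SA'.
have mhA' := preserves_measurable ph mA'_.
rewrite RintegralB//; [|exact: Linf_integrable..].
rewrite (Rintegral_setY_null LB mA mhA' AA') phiE// psiE//.
by rewrite (Rintegral_setY_null Lpsih mA mhA' AA') Rintegral_preserves// subrr.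
Qed.

(** It suffices that [w], the expectation of [u] given xi_n, has the integral of [u] over each event
    [B] of the past. The indicator of [B] may be traded for [psi] against both [w] and [u], and
    [psi], measurable for xi_n, does not distinguish [w] from [u]. *)
Lemma markov_of_spread : markov_sequence xi.
Proof.
move=> n f Lf; set u := condexp mu _ f.
set Gn := sigma_rv mu xi [set i | (i <= n)%N]; set G0 := sigma_rv mu xi [set n].
have mGn : Gn `<=` measurable := @sigma_rv_measurable _.
have mG0 : G0 `<=` measurable := @sigma_rv_measurable _.
have G0n : G0 `<=` Gn by apply: sigma_rvS => _ ->; exact: leqnn.
have [Gu _] : is_condexp mu (sigma_rv mu xi [set n.+1]) f u.
  apply: condexpP => //; first exact: sigma_algebra_rv.
  exact: sigma_rv_measurable.
have [Lu _] := Gu.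
have wP := condexpP Lu (sigma_algebra_rv [set n]) mG0.
have [Gw wE] := (is_condexpP _ Lu mG0).1 wP; have [Lw wG] := Gw.
set w := condexp mu G0 u in wP Gw wE Lw wG *.
apply: (is_condexp_unique Lu mGn); first exact: condexpP (sigma_algebra_rv _) _.
apply/is_condexpP => //; split; first by split => //; exact: subset_trans G0n.
move=> B /[dup] /mGn mB /sigma_rv_fixed/indicator_orthogonal[psi Gpsi orth].
have [Lpsi _] := Gpsi; have LB := Linf_indic mu mB; have LBpsi := LinfB LB Lpsi.
have pair v : v \in Lfun mu +oo%E ->
    \int[mu]_x ((\1_B x - psi x) * v x) = 0 ->
    \int[mu]_(x in B) v x = \int[mu]_x (psi x * v x).
  move=> Lv /eqP; under eq_Rintegral do rewrite mulrBl.
  rewrite RintegralB//; [|by apply: Linf_integrable => //; exact: LinfM..].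
  rewrite subr_eq0 => /eqP <-; rewrite -RintegralM_indic.
  by apply: eq_Rintegral => x _; rewrite mulrC.
(* [0 + n] and [1 + n] compute to [n] and [n.+1], the times at which [w] and [u] are measurable. *)
rewrite (pair w)//; last exact: Rintegral_mul_eq0 Gw (orth 0%N).
rewrite (pair u)//; last exact: Rintegral_mul_eq0 Gu (orth 1%N).
apply/eqP; rewrite -subr_eq0 -RintegralB//;
  [|by apply: Linf_integrable => //; exact: LinfM..].
under eq_Rintegral do rewrite -mulrBr mulrC.
apply/eqP; apply: (Rintegral_mul_eq0 (LinfB Lw Lu) Gpsi) => C GC.
have mC := mG0 _ GC.
by rewrite RintegralB ?wE ?subrr//; exact: Linf_integrable.
Qed.

End conditional_independence.

End generating_property.

End partial_spreadability.

Theorem theorem3p2p12 (R : realType) (d d0 : measure_display)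
    (T : measurableType d) (T0 : measurableType d0) (mu : probability T R)
    (xi : nat -> {RV mu >-> T0}) (eta : nat -> {mfun T >-> T}) :
  standard_borel R T0 ->
  standard_probability_space mu ->
  partially_spreadable xi eta ->
  generating mu eta ->
  cond_independent mu (sigma_rv mu xi [set: nat]) (fixed_sigma mu eta 0)
    (sigma_rv mu xi [set 0%N]) ->
  stationary_sequence xi /\ markov_sequence xi.
Proof.
move=> _ _ spread gen indep; split; first exact: stationary_of_spread spread.
exact: markov_of_spread spread gen indep.
Qed.
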